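(* Let $G$ be a graph. Then there exists a weight $\omega: E(G)\to\mathbb{Z}\setminus\{0\}$ such that the weighted adjacency matrix $A(G^{\omega})$ does not have full rank (i.e. has rank less than $|V(G)|$) if and only if $t(G)\geq 2$, where $t(G)$ is the number of $\{1,2\}$-factors of $G$.
   Context: All graphs are simple, undirected and finite. A $\{1,2\}$-factor of a graph $G$ is a spanning subgraph of $G$ that is a vertex-disjoint union of copies of $K_2$ and cycles; $t(G)$ denotes the number of $\{1,2\}$-factors of $G$. A weight of $G$ is a map $\omega: E(G)\to\mathbb{Z}\setminus\{0\}$. For $V(G)=\{v_1,\dots,v_n\}$, the weighted adjacency matrix $A(G^{\omega})=[a_{ij}]$ is the $n\times n$ matrix with $a_{ij}=\omega(v_iv_j)$ if $v_i$ and $v_j$ are adjacent and $a_{ij}=0$ otherwise.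
   Formalization: The formal theorem additionally assumes that G has at least one {1,2}-factor (t(G) ≥ 1); when t(G) = 0 every weight gives a singular matrix, so the stated equivalence fails (e.g. for the one-vertex graph). *)

(* Defs.v *)
From mathcomp Require Import all_boot all_order all_algebra.

Set Implicit Arguments.
Unset Strict Implicit.
Unset Printing Implicit Defensive.

Import GRing.Theory.

Record sgraph := SGraph {
  vertex :> finType;
  adj : rel vertex;
  adj_sym : symmetric adj;
  adj_irrefl : irreflexive adj
}.

Section Factors.
Variable G : sgraph.

(* An edge is the two-element set of its endpoints. *)
Definition edges : {set {set G}} :=
  [set [set x; y] | x in G, y in G & adj x y].

(* A subgraph without isolated vertices is represented by its edge set
   H : {set {set G}}; its vertex set is then cover H. *)

Definition is_K2 (H : {set {set G}}) : bool :=
  [exists x : G, exists y : G, (x != y) && (H == [set [set x; y]])].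

Definition cycle_edges (s : seq G) : {set {set G}} :=
  [set [set x; next s x] | x in s].

(* The bound n <= #|G| loses nothing, since s is duplicate-free. *)
Definition is_cycle (H : {set {set G}}) : bool :=
  [exists n : 'I_#|G|.+1, exists s : n.-tuple G,
     [&& 2 < n, uniq s & H == cycle_edges s]].

Definition vertex_disjoint (C : {set {set {set G}}}) : bool :=
  [forall H1 in C, forall H2 in C,
     (H1 != H2) ==> [disjoint cover H1 & cover H2]].

(* F is the edge set of a spanning subgraph of G; C is the family of the
   (edge sets of the) copies of K_2 and cycles of which it is the union. *)
Definition is_12factor (F : {set {set G}}) : bool :=
  [&& F \subset edges,
      cover F == [set: G]
    & [exists C : {set {set {set G}}},
         [&& [forall H in C, is_K2 H || is_cycle H],
             vertex_disjoint C
           & F == cover C]]].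

Definition num_12factors : nat := #|[set F | is_12factor F]|.

(* Only the values of w on edges matter: such a w is a map from the edges to
   the nonzero integers, extended arbitrarily to the other sets. *)
Definition is_weight (w : {set G} -> int) : Prop :=
  forall x, x \in edges -> w x != 0%R.

Definition weighted_adjmx (w : {set G} -> int) : 'M[int]_#|G| :=
  \matrix_(i, j) (if adj (enum_val i) (enum_val j)
                  then w [set enum_val i; enum_val j] else 0%R).

(* The rank of an integer matrix is its rank over the rationals. *)
Definition int_rank m n (A : 'M[int]_(m, n)) : nat :=
  \rank (map_mx (intr : int -> rat) A).

End Factors.

(* Main.v *)
Require Import Defs.
From mathcomp Require Import all_boot all_order all_algebra.
From mathcomp Require Import fingroup perm all_field.

(* The {1,2}-factors of G are the edge sets {{x, s x}} of the permutations s
   that move every vertex to a neighbour, and two such permutations with the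
   same edge set contribute equal terms to the Leibniz expansion of the
   determinant. If there is only one factor, the determinant is therefore a
   nonzero multiple of a single term.

   If there are two, some edge e0 lies in one and not in the other. For generic
   algebraic weights on the remaining edges, the determinant is a nonconstant
   polynomial in the weight of e0 with nonzero constant term, so it has a
   nonzero root. To return to the integers, rescale rows and columns by a null
   vector: the matrix then has a 0/1 null vector, i.e. the weights around each
   vertex satisfy a linear equation with coefficients 0 and 1. A Q-linear form
   on the number field of the weights preserves these equations, and a generic
   one vanishes at no weight. *)

Set Implicit Arguments.
Unset Strict Implicit.
Unset Printing Implicit Defensive.

Import GRing.Theory Num.Theory.

Section PermEdges.
Variable T : finType.
Implicit Types (s t : {perm T}) (E F : {set {set T}}).

Definition perm_edges s : {set {set T}} := [set [set x; s x] | x : T].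

Definition perm_supports E : {set {set {set T}}} :=
  [set perm_edges s | s : {perm T} & perm_edges s \subset E].

Lemma eq_set2 (a b c d : T) :
  ([set a; b] == [set c; d]) = (a == c) && (b == d) || (a == d) && (b == c).
Proof.
apply/eqP/idP => [/setP eq_ab_cd|].
  have := (eq_ab_cd a, eq_ab_cd b, eq_ab_cd c, eq_ab_cd d).
  rewrite !inE !eqxx ?orbT /= ![c == _]eq_sym ![d == _]eq_sym.
  by do 4![case: (_ == _) => //=] => -[[[]]].
by case/orP=> /andP[/eqP-> /eqP->] //; rewrite setUC.
Qed.

Lemma mem_perm_edges s x y :
  ([set x; y] \in perm_edges s) = (y == s x) || (y == (s^-1)%g x).
Proof.
apply/imsetP/orP => [[z _ /eqP]|[]/eqP->]; last 2 first.
- by exists x.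
- by exists ((s^-1)%g x); rewrite ?permKV 1?setUC.
rewrite eq_set2 => /orP[] /andP[/eqP-> /eqP->]; first by left.
by right; rewrite permK.
Qed.

Lemma sub_perm_edges s F :
  (perm_edges s \subset F) = [forall x, [set x; s x] \in F].
Proof.
apply/subsetP/forallP => [sF x|sF e /imsetP[x _ ->] //].
by apply: sF; apply: imset_f.
Qed.

Lemma perm_edges_neighbours s t x : perm_edges s = perm_edges t ->
  (s x == t x) && ((s^-1)%g x == (t^-1)%g x)
  || (s x == (t^-1)%g x) && ((s^-1)%g x == t x).
Proof.
move=> eq_st; rewrite -eq_set2; apply/eqP/setP => y.
by rewrite !inE -!mem_perm_edges eq_st.
Qed.

Definition edge_mult s (e : {set T}) := \sum_x ([set x; s x] == e).

(* A permutation and its inverse traverse every edge equally often, and the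
   pair {s x, s^-1 x} is determined by the support. *)
Lemma eq_edge_mult s t e :
  perm_edges s = perm_edges t -> edge_mult s e = edge_mult t e.
Proof.
move=> eq_st.
have edge_multV r : edge_mult r e = \sum_x ([set x; (r^-1)%g x] == e).
  rewrite /edge_mult (reindex_inj (@perm_inj _ (r^-1)%g)) /=.
  by apply: eq_bigr => x _; rewrite permKV setUC.
apply: double_inj; rewrite -!addnn {2}(edge_multV s) {2}(edge_multV t).
rewrite /edge_mult -!big_split; apply: eq_bigr => x _ /=.
case/orP: (perm_edges_neighbours x eq_st) => /andP[/eqP-> /eqP->] //.
by rewrite addnC.
Qed.

Lemma prod_edge_mult (R : comPzSemiRingType) (W : {set T} -> R) s :
  (\prod_x W [set x; s x] = \prod_e W e ^+ edge_mult s e)%R.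
Proof.
rewrite (partition_big (fun x => [set x; s x]) predT) //=.
apply: eq_bigr => e _; rewrite (eq_bigr (fun=> W e)) => [|x /eqP-> //].
by rewrite prodr_const -sum1_card big_mkcond.
Qed.

Lemma eq_prod_perm_edges (R : comPzSemiRingType) (W : {set T} -> R) s t :
  perm_edges s = perm_edges t ->
  (\prod_x W [set x; s x] = \prod_x W [set x; t x])%R.
Proof.
move=> eq_st; rewrite !prod_edge_mult.
by apply: eq_bigr => e _; rewrite (eq_edge_mult e eq_st).
Qed.

Lemma porbit_sub_perm_edges s t x :
  perm_edges s = perm_edges t -> porbit s x \subset porbit t x.
Proof.
move=> eq_st; apply/subsetP => y /porbitP[k ->]{y}.
elim: k => [|k IHk]; first by rewrite expg0 perm1 porbit_id.
rewrite expgSr permM; move: IHk; set y := (s ^+ k)%g x.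
rewrite -!eq_porbit_mem => /eqP <-.
case/orP: (perm_edges_neighbours y eq_st) => /andP[/eqP-> _].
  by rewrite (porbit_perm t 1).
by rewrite -!(porbitV t) (porbit_perm (t^-1)%g 1).
Qed.

Lemma eq_odd_perm_edges s t :
  perm_edges s = perm_edges t -> odd_perm s = odd_perm t.
Proof.
move=> eq_st; rewrite /odd_perm; congr (_ (+) odd #|pred_of_set _|).
apply: eq_imset => x; apply/eqP.
by rewrite eqEsubset !porbit_sub_perm_edges.
Qed.

Section SumOfSigns.
Local Open Scope ring_scope.

Definition nowhere_zero (R : nmodType) E (W : {set T} -> R) :=
  {in E, forall e, W e != 0}.

Lemma sum_same_perm_edges_neq0 (R : numDomainType) (W : {set T} -> R) s :
  nowhere_zero (perm_edges s) W ->
  \sum_(t : {perm T} | perm_edges t == perm_edges s)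
     (-1) ^+ t * \prod_x W [set x; t x] != 0.
Proof.
move=> Wnz; rewrite (eq_bigr (fun=> (-1) ^+ s * \prod_x W [set x; s x])).
  rewrite sumr_const mulrn_eq0 negb_or -lt0n; apply/andP; split.
    by apply/card_gt0P; exists s; apply: eqxx.
  rewrite mulf_neq0 ?signr_eq0 //; apply/prodf_neq0 => x _.
  by apply: Wnz; apply: imset_f.
move=> t /eqP eq_ts.
by rewrite (eq_prod_perm_edges W eq_ts) (eq_odd_perm_edges eq_ts).
Qed.

(* For a minimal support satisfying Q, all terms of the sum have the same
   sign. *)
Lemma exists_sum_signs_neq0 (R : numDomainType) (Q : pred {set {set T}}) s0 :
  Q (perm_edges s0) ->
  exists2 s : {perm T}, perm_edges s \subset perm_edges s0 &
    \sum_(t : {perm T} | (perm_edges t \subset perm_edges s)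
                         && Q (perm_edges t)) (-1) ^+ t != 0 :> R.
Proof.
move=> Qs0.
pose P s := (perm_edges s \subset perm_edges s0) && Q (perm_edges s).
have Ps0 : P s0 by rewrite /P subxx.
have [s /andP[s_s0 Qs] min_s] := arg_minnP (fun s => #|perm_edges s|) Ps0.
exists s => //.
rewrite (eq_bigl (fun t => perm_edges t == perm_edges s)) => [|t].
  have := @sum_same_perm_edges_neq0 R (fun=> 1) s (fun _ _ => oner_neq0 _).
  rewrite (eq_bigr (fun t : {perm T} => (-1) ^+ t)) // => t _.
  by rewrite big1 ?mulr1.
apply/andP/eqP => [[t_s Qt]|->]; last by [].
apply/eqP; rewrite eqEcard t_s min_s // /P Qt andbT.
exact: subset_trans s_s0.
Qed.

End SumOfSigns.
End PermEdges.

Section ConjugatePermutation.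
Variables (S T : finType) (f : S -> T) (g : T -> S).
Hypotheses (fK : cancel f g) (gK : cancel g f).

Lemma conj_perm_inj (s : {perm S}) : injective (f \o s \o g).
Proof. exact: inj_comp (inj_comp (can_inj fK) perm_inj) (can_inj gK). Qed.

Definition conj_perm (s : {perm S}) : {perm T} := perm (@conj_perm_inj s).

Lemma conj_permE s x : conj_perm s x = f (s (g x)).
Proof. by rewrite permE. Qed.

Lemma conj_perm_tperm x y : conj_perm (tperm x y) = tperm (f x) (f y).
Proof.
apply/permP => z; rewrite conj_permE -{2}[z]gK.
exact: inj_tperm (can_inj fK).
Qed.

Lemma conj_perm_prod (I : Type) (r : seq I) (F : I -> {perm S}) :
  conj_perm (\prod_(i <- r) F i)%g = (\prod_(i <- r) conj_perm (F i))%g.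
Proof.
apply: (big_morph conj_perm) => [s t|]; apply/permP => x.
  by rewrite permM !conj_permE fK permM.
by rewrite conj_permE !perm1 gK.
Qed.

Lemma odd_conj_perm s : odd_perm (conj_perm s) = odd_perm s.
Proof.
have [ts -> dts] := prod_tpermP s; rewrite conj_perm_prod odd_perm_prod //.
under eq_bigr => t _ do rewrite conj_perm_tperm.
rewrite -(big_map (fun t => (f t.1, f t.2)) xpredT (fun t => tperm t.1 t.2)).
rewrite odd_perm_prod ?size_map // all_map; apply: sub_all dts => t /=.
by rewrite (can_eq fK).
Qed.

End ConjugatePermutation.

Section EdgeMatrix.
Local Open Scope ring_scope.
Variable T : finType.
Implicit Types (E F : {set {set T}}) (s t : {perm T}).

Lemma det_enum_val (R : comPzRingType) (M : T -> T -> R) :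
  \det (\matrix_(i, j < #|T|) M (enum_val i) (enum_val j))
  = \sum_(s : {perm T}) (-1) ^+ s * \prod_x M x (s x).
Proof.
pose h := conj_perm (@enum_rankK T) (@enum_valK T).
pose h' := conj_perm (@enum_valK T) (@enum_rankK T).
rewrite /determinant (reindex h) /=.
  apply: eq_bigr => s _; rewrite odd_conj_perm; congr (_ * _).
  rewrite (reindex _ (onW_bij _ (@enum_rank_bij T))).
  by apply: eq_bigr => x _; rewrite mxE conj_permE !enum_rankK.
exists h' => s _; apply/permP => x; rewrite !conj_permE.
  by rewrite !enum_rankK.
by rewrite !enum_valK.
Qed.

Definition edge_mx (R : nmodType) E (W : {set T} -> R) : 'M[R]_#|T| :=
  \matrix_(i, j) let e := [set enum_val i; enum_val j] in
                 if e \in E then W e else 0.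

Lemma det_edge_mx (R : comPzRingType) E (W : {set T} -> R) :
  \det (edge_mx E W)
  = \sum_(s : {perm T} | perm_edges s \subset E)
       (-1) ^+ s * \prod_x W [set x; s x].
Proof.
rewrite (det_enum_val
  (fun x y => if [set x; y] \in E then W [set x; y] else 0)).
rewrite [RHS]big_mkcond; apply: eq_bigr => s _; rewrite sub_perm_edges.
case: forallP => [sE|/forallP]; first by under eq_bigr => x _ do rewrite sE.
rewrite negb_forall => /existsP[x /negbTE xE].
by rewrite (bigD1 x) //= xE mul0r mulr0.
Qed.

Lemma det_edge_mx_unique_support (R : numDomainType) E (W : {set T} -> R) :
  #|perm_supports E| = 1%N -> nowhere_zero E W -> \det (edge_mx E W) != 0.
Proof.
move/eqP/cards1P => [F supE] Wnz.
have: F \in perm_supports E by rewrite supE set11.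
case/imsetP=> s; rewrite inE => sE eF.
rewrite det_edge_mx (eq_bigl (fun t => perm_edges t == perm_edges s)).
  by apply: sum_same_perm_edges_neq0 => e /(subsetP sE); apply: Wnz.
move=> t; apply/idP/eqP => [tE|-> //]; apply/set1P; rewrite -eF -supE.
by apply: imset_f; rewrite inE.
Qed.

Lemma det_edge_mx_eq0P (R : idomainType) E (W : {set T} -> R) :
  reflect (exists2 y : T -> R, exists x, y x != 0
             & forall z, \sum_(x | [set x; z] \in E) y x * W [set x; z] = 0)
          (\det (edge_mx E W) == 0).
Proof.
have mul_edge_mx (v : 'rV[R]_#|T|) z : (v *m edge_mx E W) 0 (enum_rank z)
    = \sum_(x | [set x; z] \in E) v 0 (enum_rank x) * W [set x; z].
  rewrite mxE (reindex _ (onW_bij _ (@enum_rank_bij T))) [RHS]big_mkcond /=.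
  apply: eq_bigr => x _; rewrite mxE !enum_rankK /=.
  by case: ifP; rewrite ?mulr0.
apply: (iffP det0P) => [[v vnz vM]|[y [x yx] yW]].
  exists (fun x => v 0 (enum_rank x)) => [|z]; last first.
    by rewrite -mul_edge_mx vM mxE.
  by case/rV0Pn: vnz => i vi; exists (enum_val i); rewrite enum_valK.
exists (\row_i y (enum_val i)).
  by apply/rV0Pn; exists (enum_rank x); rewrite mxE enum_rankK.
apply/rowP => j; rewrite -[j]enum_valK mul_edge_mx mxE -[RHS](yW (enum_val j)).
by apply: eq_bigr => z _; rewrite mxE enum_rankK.
Qed.

End EdgeMatrix.

Section PolynomialOnLines.
Local Open Scope ring_scope.

Definition poly_on_lines (R : nzRingType) (V : lmodType R) (f : V -> R) :=
  forall v w, exists p : {poly R}, forall x, f (v + x *: w) = p.[x].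

Lemma poly_on_lines_linear (R : comNzRingType) (V : lmodType R) (f : V -> R) :
  linear_for *%R f -> poly_on_lines f.
Proof.
move=> lin_f v w; exists ((f v)%:P + f w *: 'X) => x.
by rewrite addrC lin_f !hornerE addrC mulrC.
Qed.

Lemma poly_on_linesM (R : comNzRingType) (V : lmodType R) (f g : V -> R) :
  poly_on_lines f -> poly_on_lines g -> poly_on_lines (fun v => f v * g v).
Proof.
move=> pf pg v w; have [p fE] := pf v w; have [q gE] := pg v w.
by exists (p * q) => x; rewrite hornerM fE gE.
Qed.

Lemma poly_on_linesB (R : nzRingType) (V : lmodType R) (f g : V -> R) :
  poly_on_lines f -> poly_on_lines g -> poly_on_lines (fun v => f v - g v).
Proof.
move=> pf pg v w; have [p fE] := pf v w; have [q gE] := pg v w.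
by exists (p - q) => x; rewrite hornerD hornerN fE gE.
Qed.

Lemma exists_nonroot (R : numDomainType) (p : {poly R}) :
  p != 0 -> exists x, p.[x] != 0.
Proof.
move=> p_neq0; pose rs : seq R := [seq i%:R | i <- iota 0 (size p)].
have [/hasP[x _ px]|] := boolP (has (fun x => ~~ root p x) rs).
  by exists x.
rewrite has_predC negbK => /(max_poly_roots p_neq0).
rewrite map_inj_uniq ?iota_uniq; last exact/mulrIn/oner_neq0.
by rewrite size_map size_iota ltnn => /(_ isT).
Qed.

Lemma exists_common_neq0 (R : numDomainType) (V : lmodType R) (J : finType)
    (f : J -> V -> R) :
  (forall j, poly_on_lines (f j)) -> (forall j, exists v, f j v != 0) ->
  exists v, forall j, f j v != 0.
Proof.
move=> pf nzf.
have [_ [v]] : poly_on_lines (fun v => \prod_j f j v)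
    /\ exists v, \prod_j f j v != 0.
  elim: (index_enum J) => [|j r [pr [v nzv]]].
    split; last by exists 0; rewrite big_nil oner_neq0.
    by move=> v w; exists 1 => x; rewrite big_nil hornerC.
  split.
    move=> u w; have [p pE] := poly_on_linesM (pf j) pr u w.
    by exists p => x; rewrite big_cons pE.
  have [w nzw] := nzf j.
  have [p pE] := pf j v (w - v); have [q qE] := pr v (w - v).
  have p_neq0 : p != 0.
    apply: contraNneq nzw => p0.
    by rewrite -[w](subrKC v) -[w - v]scale1r pE p0 horner0.
  have q_neq0 : q != 0.
    apply: contraNneq nzv => q0.
    by rewrite -[v]addr0 -[0](scale0r (w - v)) qE q0 horner0.
  have [x] := exists_nonroot (mulf_neq0 p_neq0 q_neq0).
  rewrite hornerM -pE -qE => nzx.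
  by exists (v + x *: (w - v)); rewrite big_cons.
by move=> /prodf_neq0 nzv; exists v => j; apply: nzv.
Qed.

Lemma exists_linear_form_neq0 (K : numFieldType) (V : vectType K) (I : finType)
    (v : I -> V) :
  exists phi : {linear V -> K^o}, forall i, v i != 0 -> phi (v i) != 0.
Proof.
pose f i (phi : 'Hom(V, K^o)) : K := if v i == 0 then 1 else phi (v i).
have [i|i|phi nz_phi] := @exists_common_neq0 K _ _ f.
- rewrite /f; case: eqP => _.
    by move=> _ _; exists 1 => x; rewrite hornerC.
  by apply: poly_on_lines_linear => x phi psi; rewrite !lfunE /= lfunE.
- rewrite /f; case: eqP => [_|/eqP vi]; first by exists 0; rewrite oner_neq0.
  have [k vik|coord0] := pickP (fun k => coord (vbasis {:V}) k (v i) != 0).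
    by exists (linfun (coord (vbasis {:V}) k : V -> K^o)); rewrite lfunE.
  case/eqP: vi; rewrite [v i](coord_vbasis (memvf _)) big1 // => k _.
  by rewrite (eqP (negbFE (coord0 k))) scale0r.
by exists phi => i /negbTE vi; have := nz_phi i; rewrite /f vi.
Qed.

End PolynomialOnLines.

Section NowhereZeroRoot.
Local Open Scope ring_scope.
Variable I : finType.

Definition set_coord (R : Type) (v : {ffun I -> R}) i x : {ffun I -> R} :=
  [ffun j => if j == i then x else v j].

Lemma poly_on_lines_set_coord (R : nzRingType) (f : {ffun I -> R^o} -> R) i c :
  poly_on_lines f -> poly_on_lines (fun v => f (set_coord v i c)).
Proof.
move=> pf v w; have [p pE] := pf (set_coord v i c) (set_coord w i 0).
exists p => x; rewrite -pE; congr f; apply/ffunP => j; rewrite !ffunE.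
by case: eqP => // _; rewrite scaler0 addr0.
Qed.

Lemma exists_nowhere_zero_root (K : numClosedFieldType)
    (f : {ffun I -> K^o} -> K) i :
  poly_on_lines f -> (exists v, f (set_coord v i 0) != 0) ->
  (exists v, f v != f (set_coord v i 0)) ->
  exists2 w : {ffun I -> K^o}, (forall j, w j != 0) & f w = 0.
Proof.
move=> pf nz_f0 nz_df; have pf0 := poly_on_lines_set_coord i 0 pf.
pose g (j : option (option I)) (v : {ffun I -> K^o}) : K :=
  match j with
  | None => f (set_coord v i 0)
  | Some None => f v - f (set_coord v i 0)
  | Some (Some j) => v j
  end.
have [j|j|v nzv] := @exists_common_neq0 K _ _ g.
- case: j => [[j|]|] //=; last exact: poly_on_linesB.
  by apply: poly_on_lines_linear => x v w; rewrite /g !ffunE.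
- case: j => [[j|]|] //=.
    by exists [ffun=> 1]; rewrite ffunE oner_neq0.
  by case: nz_df => v nzv; exists v; rewrite subr_eq0.
have [p pE] := pf (set_coord v i 0) (set_coord 0 i 1).
have {}pE x : f (set_coord v i x) = p.[x].
  rewrite -pE; congr f; apply/ffunP => j; rewrite !ffunE.
  by case: eqP => _; rewrite ?scaler0 ?addr0 // add0r [RHS]mulr1.
have vE : set_coord v i (v i) = v.
  by apply/ffunP => j; rewrite ffunE; case: eqP => // ->.
have /closed_rootP[x /rootP px] : size p != 1%N.
  apply: contraNneq (nzv (Some None)) => /eqP/size_poly1P[c _ pc].
  by rewrite /g -[X in f X - _]vE !pE pc !hornerC subrr.
exists (set_coord v i x); last by rewrite pE.
move=> j; rewrite ffunE; case: (j =P i) => _; last exact: (nzv (Some (Some j))).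
by apply: contra_eq_neq px => ->; rewrite -pE; apply: (nzv None).
Qed.

End NowhereZeroRoot.

Section FiniteFamiliesOfNumbers.
Local Open Scope ring_scope.
Variable I : finType.

Lemma exists_num_field_family (a : I -> algC) :
  exists (Q : fieldExtType rat) (QtoC : {rmorphism Q -> algC}) (b : I -> Q),
    forall i, QtoC (b i) = a i.
Proof.
have [Q [QtoC [s s_a _]]] := num_field_exists [seq a i | i : I].
exists Q, QtoC; suff /fin_all_exists[b] : forall i, exists b, QtoC b = a i.
  by exists b.
move=> i; have: a i \in [seq QtoC b | b <- s] by rewrite s_a; apply: image_f.
by case/mapP=> b _ ->; exists b.
Qed.

Lemma exists_common_denominator (V : I -> rat) :
  exists2 d : int, d != 0 & forall i, exists m : int, m%:~R = d%:~R * V i.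
Proof.
exists (\prod_i denq (V i)); first by apply/prodf_neq0 => i _; apply: denq_neq0.
move=> i; exists (numq (V i) * \prod_(j | j != i) denq (V j)).
by rewrite [in RHS](bigD1 i) //= !rmorphM /= numqE [RHS]mulrC mulrA.
Qed.

End FiniteFamiliesOfNumbers.

Section SingularWeights.
Local Open Scope ring_scope.
Variable T : finType.
Implicit Types (E F : {set {set T}}) (S : {set T}).

Lemma poly_on_lines_det_edge_mx (R : comNzRingType) E :
  poly_on_lines (fun W : {ffun {set T} -> R^o} => \det (@edge_mx T R E W)).
Proof.
move=> V W; pose q e : {poly R} := (V e : R)%:P + (W e : R) *: 'X.
exists (\det (edge_mx E q)) => x; rewrite -horner_evalE -det_map_mx.
congr (\det _); apply/matrixP => i j; rewrite !mxE /=.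
rewrite /horner_eval; case: ifP => _; last by rewrite horner0.
by rewrite !ffunE !hornerE mulrC.
Qed.

Definition indicator_weight (R : nzRingType) F : {ffun {set T} -> R^o} :=
  [ffun e => (e \in F)%:R].

Lemma set_coord_indicator_weight (R : nzRingType) F e :
  set_coord (indicator_weight R F) e 0 = indicator_weight R (F :\ e).
Proof. by apply/ffunP => e'; rewrite !ffunE in_setD1; case: (e' == e). Qed.

Lemma det_edge_mx_indicator (R : comNzRingType) E F : F \subset E ->
  \det (@edge_mx T R E (indicator_weight R F))
  = \sum_(s : {perm T} | perm_edges s \subset F) (-1) ^+ s.
Proof.
move=> FE; transitivity (\det (edge_mx F (fun=> 1 : R))).
  congr (\det _); apply/matrixP => i j; rewrite !mxE /= ffunE.
  by case: ifPn => [_|eE]; [case: ifP | rewrite (contraNF (subsetP FE _) eE)].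
by rewrite det_edge_mx; apply: eq_bigr => s _; rewrite big1 ?mulr1.
Qed.

Lemma exists_closed_singular_weight (K : numClosedFieldType) E :
  (1 < #|perm_supports E|)%N ->
  exists2 W : {set T} -> K, nowhere_zero E W & \det (edge_mx E W) = 0.
Proof.
case/card_gt1P=> F1 [F2 [F1E F2E neqF]].
wlog /subsetPn[e0 e0F1 e0F2] : F1 F2 F1E F2E neqF / ~~ (F1 \subset F2).
  move=> IH; have [sF|/IH] := boolP (F1 \subset F2); last exact.
  apply: (IH F2 F1) => //; first by rewrite eq_sym.
  by apply: contra neqF => sF'; rewrite eqEsubset sF.
case/imsetP: F1E e0F1 => s1; rewrite inE => s1E -> e0s1.
case/imsetP: F2E e0F2 => s2; rewrite inE => s2E -> e0s2.
have [||W Wnz detW] :=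
    exists_nowhere_zero_root (i := e0) (@poly_on_lines_det_edge_mx K E).
- have [s s_s2 nz_s] := @exists_sum_signs_neq0 T K xpredT s2 isT.
  have e0s : e0 \notin perm_edges s by apply: contra e0s2 => /(subsetP s_s2).
  exists (indicator_weight K (perm_edges s)).
  rewrite set_coord_indicator_weight det_edge_mx_indicator.
    rewrite (setDidPl _) 1?disjoint_sym ?disjoints1 //.
    by under eq_bigl => t do rewrite -[_ \subset _]andbT.
  exact: subset_trans (subD1set _ _) (subset_trans s_s2 s2E).
- have [s s_s1 nz_s] :=
    @exists_sum_signs_neq0 T K (fun F => e0 \in F) s1 e0s1.
  have sE := subset_trans s_s1 s1E.
  exists (indicator_weight K (perm_edges s)).
  rewrite set_coord_indicator_weight !det_edge_mx_indicator //; last first.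
    exact: subset_trans (subD1set _ _) sE.
  rewrite -subr_eq0 (bigID (fun t => e0 \in perm_edges t)) /=.
  by under [X in _ - X]eq_bigl => t do rewrite subsetD1; rewrite addrK.
by exists W => // e _.
Qed.

(* The indicator vector of S is a null vector of edge_mx E W. *)
Definition balanced (R : nmodType) E S (W : {set T} -> R) :=
  forall z, \sum_(x in S | [set x; z] \in E) W [set x; z] = 0.

Lemma balanced_singular (R : idomainType) E S (W : {set T} -> R) :
  S != set0 -> balanced E S W -> \det (edge_mx E W) = 0.
Proof.
case/set0Pn=> x xS balW; apply/eqP/det_edge_mx_eq0P.
exists (fun x => (x \in S)%:R) => [|z]; first by exists x; rewrite xS oner_neq0.
rewrite -[RHS](balW z) [RHS]big_mkcondl; apply: eq_bigr => y _.
by case: ifP; rewrite ?mul1r ?mul0r.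
Qed.

(* With y a null vector of the matrix of W, the weight
   W' {x,z} = W {x,z} y_x y_z, where y_x is read as 1 when it vanishes, is
   balanced on the support of y. *)
Lemma exists_balanced_rescaling (R : idomainType) E (W : {set T} -> R) :
  (forall x, [set x] \notin E) -> nowhere_zero E W -> \det (edge_mx E W) = 0 ->
  exists S (W' : {set T} -> R),
    [/\ S != set0, nowhere_zero E W' & balanced E S W'].
Proof.
move=> loopE Wnz /eqP/det_edge_mx_eq0P[y [x0 yx0] yW].
pose c x := if y x == 0 then 1 else y x.
have cnz x : c x != 0 by rewrite /c; case: ifPn => // _; apply: oner_neq0.
exists [set x | y x != 0], (fun e => W e * \prod_(x in e) c x).
split=> [|e eE|z].
- by apply/set0Pn; exists x0; rewrite inE.
- by rewrite mulf_neq0 ?Wnz //; apply/prodf_neq0.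
transitivity (c z * \sum_(x | [set x; z] \in E) y x * W [set x; z]); last first.
  by rewrite yW mulr0.
rewrite mulr_sumr big_mkcondl; apply: eq_bigr => x xzE; rewrite inE.
case: ifPn => [yx|]; last by rewrite negbK => /eqP->; rewrite mul0r mulr0.
have xz : x != z by apply: contraTneq xzE => ->; rewrite setUid.
rewrite big_setU1 ?inE //= big_set1 [c x]/c (negbTE yx).
by rewrite mulrCA [RHS]mulrCA [W _ * _]mulrC.
Qed.

Lemma exists_rat_balanced (W : {set T} -> algC) E S :
  nowhere_zero E W -> balanced E S W ->
  exists2 V : {set T} -> rat, nowhere_zero E V & balanced E S V.
Proof.
move=> Wnz balW; have [Q [QtoC [U UW]]] := exists_num_field_family W.
have [phi nz_phi] := exists_linear_form_neq0 U.
exists (fun e => phi (U e)) => [e eE|z].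
  by apply: nz_phi; rewrite -(fmorph_eq0 QtoC) UW Wnz.
have balU : \sum_(x in S | [set x; z] \in E) U [set x; z] = 0.
  apply: (fmorph_inj QtoC); rewrite rmorph_sum rmorph0 -[RHS](balW z).
  by apply: eq_bigr => x _; apply: UW.
by rewrite -linear_sum balU linear0.
Qed.

Lemma exists_int_balanced (V : {set T} -> rat) E S :
  nowhere_zero E V -> balanced E S V ->
  exists2 W : {set T} -> int, nowhere_zero E W & balanced E S W.
Proof.
move=> Vnz balV.
have [d d0 /fin_all_exists[W WE]] := exists_common_denominator V.
exists W => [e eE|z].
  by rewrite -(intr_eq0 rat) WE mulf_neq0 ?intr_eq0 ?Vnz.
apply/eqP; rewrite -(intr_eq0 rat) rmorph_sum /=.
by under eq_bigr => x _ do rewrite WE; rewrite -mulr_sumr balV mulr0.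
Qed.

Lemma exists_int_singular_weight E :
  (forall x, [set x] \notin E) -> (1 < #|perm_supports E|)%N ->
  exists2 W : {set T} -> int, nowhere_zero E W & \det (edge_mx E W) = 0.
Proof.
move=> loopE /(exists_closed_singular_weight algC)[U Unz detU].
have [S [U' [S0 U'nz balU']]] := exists_balanced_rescaling loopE Unz detU.
have [V Vnz balV] := exists_rat_balanced U'nz balU'.
have [W Wnz balW] := exists_int_balanced Vnz balV.
by exists W => //; apply: balanced_singular balW.
Qed.

End SingularWeights.

Section FactorsArePermutations.
Variable G : sgraph.
Implicit Types (x y : G) (p : seq G) (s : {perm G}) (F H : {set {set G}}).

Lemma mem_edges x y : ([set x; y] \in edges G) = adj x y.
Proof.
apply/imset2P/idP => [[a b _]|xy]; last by exists x y; rewrite ?inE.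
rewrite inE => /andP[_ ab] /eqP; rewrite eq_set2.
by case/orP=> /andP[/eqP-> /eqP->] //; rewrite adj_sym.
Qed.

Lemma edges_loopless x : [set x] \notin edges G.
Proof. by rewrite -[[set x]]setUid mem_edges adj_irrefl. Qed.

Lemma cover_cycle_edges p : cover (cycle_edges p) =i p.
Proof.
move=> y; rewrite cover_imset; apply/bigcupP/idP => [[x xp]|yp].
  by rewrite !inE => /orP[] /eqP-> //; rewrite mem_next.
by exists y; rewrite ?set21.
Qed.

Lemma cycle_edges_pair x y :
  x != y -> cycle_edges [:: x; y] = [set [set x; y]].
Proof.
move=> xy; apply/setP => e; rewrite inE; apply/imsetP/eqP => [[z]|->].
  rewrite !inE => /orP[] /eqP-> ->;
    by rewrite /= ?[y == x]eq_sym ?(negbTE xy) eqxx // setUC.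
by exists x; rewrite ?inE /= eqxx.
Qed.

Lemma K2_or_cycleP H :
  reflect (exists p, [/\ 1 < size p, uniq p & H = cycle_edges p])
          (is_K2 H || is_cycle H).
Proof.
apply: (iffP orP) => [[]|[p [p_gt1 p_uniq ->]]].
- case/existsP=> x /existsP[y /andP[xy /eqP->]].
  by exists [:: x; y]; rewrite /= inE xy cycle_edges_pair.
- case/existsP=> n /existsP[p /and3P[n_gt2 p_uniq /eqP->]].
  by exists p; rewrite size_tuple ltnW.
have [p2|p_gt2] := leqP (size p) 2.
  case: p p_gt1 p_uniq p2 => [|x [|y []]] //= _; rewrite inE andbT => xy _.
  left; apply/existsP; exists x; apply/existsP; exists y.
  by rewrite xy cycle_edges_pair /=.
have p_leG : size p < #|G|.+1 by rewrite ltnS -(card_uniqP p_uniq) max_card.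
right; apply/existsP; exists (Ordinal p_leG); apply/existsP.
by exists (in_tuple p); rewrite /= p_gt2 p_uniq eqxx.
Qed.

Lemma cycle_edges_orbit s x :
  cycle_edges (orbit s x) = [set [set y; s y] | y in orbit s x].
Proof.
apply: eq_in_imset => y yx.
by rewrite -(eqP (next_cycle (cycle_orbit (@perm_inj _ s) x) yx)).
Qed.

Lemma cover_perm_cycles s :
  perm_edges s = cover [set cycle_edges (orbit s x) | x : G].
Proof.
apply/setP => e; apply/imsetP/bigcupP => [[x _ ->]|[_ /imsetP[x _ ->]]].
  exists (cycle_edges (orbit s x)); first exact: imset_f.
  by rewrite cycle_edges_orbit; apply: imset_f; apply: in_orbit.
by rewrite cycle_edges_orbit => /imsetP[y _ ->]; exists y.
Qed.

Lemma vertex_disjoint_perm_cycles s :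
  vertex_disjoint [set cycle_edges (orbit s x) | x : G].
Proof.
have s_sym : connect_sym (frel s) := fconnect_sym (@perm_inj _ s).
apply/forall_inP => _ /imsetP[x _ ->]; apply/forall_inP => _ /imsetP[y _ ->].
apply/implyP; apply: contraR => /pred0Pn[z /=].
rewrite !cover_cycle_edges -!fconnect_orbit => /andP[xz].
rewrite s_sym => /(connect_trans xz) xy.
rewrite !cycle_edges_orbit; apply/eqP/setP => e.
have eq_xy : orbit s x =i orbit s y.
  by move=> u; rewrite -!fconnect_orbit (same_connect s_sym xy).
by apply/imsetP/imsetP => -[u ux ->]; exists u; rewrite // (eq_xy, =^~ eq_xy).
Qed.

Lemma perm_edges_12factor s :
  perm_edges s \subset edges G -> is_12factor (perm_edges s).
Proof.
move=> sE; have neq_sx x : x != s x.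
  have: adj x (s x) by rewrite -mem_edges (subsetP sE) //; apply: imset_f.
  by apply: contraTneq => <-; rewrite adj_irrefl.
apply/and3P; split=> //.
  apply/eqP/setP => x; rewrite inE; apply/bigcupP.
  by exists [set x; s x]; rewrite ?set21 //; apply: imset_f.
apply/existsP; exists [set cycle_edges (orbit s x) | x : G].
rewrite vertex_disjoint_perm_cycles cover_perm_cycles eqxx !andbT.
apply/forall_inP => _ /imsetP[x _ ->]; apply/K2_or_cycleP.
exists (orbit s x); split; rewrite ?orbit_uniq // size_orbit.
by apply/card_gt1P; exists x, (s x); rewrite !inE connect0 fconnect1.
Qed.

Lemma cycles_of_12factor F : is_12factor F ->
  exists p : G -> seq G,
    [/\ forall x, uniq (p x), forall x, x \in p x,
        forall x y, y \in p x -> p y = p x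
      & F = [set [set x; next (p x) x] | x : G]].
Proof.
case/and3P=> _ /eqP covF /existsP[C /and3P[/forall_inP cycC disjC /eqP FC]].
have /fin_all_exists[c cP] : forall H : {set {set G}},
    exists p, H \in C -> uniq p /\ H = cycle_edges p.
  move=> H; case: (boolP (H \in C)) => [HC|_]; last by exists [::].
  by have /K2_or_cycleP[p [_ p_uniq eH]] := cycC H HC; exists p.
have cov H : H \in C -> cover H =i c H.
  by move=> HC x; rewrite {1}(cP H HC).2 cover_cycle_edges.
have /fin_all_exists[h hP] : forall x : G, exists H, H \in C /\ x \in c H.
  move=> x; have : x \in cover F by rewrite covF inE.
  case/bigcupP=> e; rewrite FC => /bigcupP[H HC eH] xe.
  by exists H; rewrite -cov //; split=> //; apply/bigcupP; exists e.
have h_uniq x H : H \in C -> x \in c H -> h x = H.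
  move=> HC xH; apply/eqP; apply: contraT => neqH; have [hC xh] := hP x.
  have /forall_inP/(_ _ hC)/forall_inP/(_ _ HC) := disjC.
  by rewrite neqH => /pred0P/(_ x) /=; rewrite !cov // xh xH.
exists (fun x => c (h x)); split=> [x|x|x y yx|].
- exact: (cP _ (hP x).1).1.
- exact: (hP x).2.
- by rewrite (h_uniq y (h x)) //; apply: (hP x).1.
apply/setP => e; rewrite FC; apply/bigcupP/imsetP => [[H HC]|[x _ ->]].
  rewrite (cP H HC).2 => /imsetP[y yH ->]; exists y => //.
  by rewrite (h_uniq y H).
have [hC xh] := hP x; exists (h x) => //.
have: [set x; next (c (h x)) x] \in cycle_edges (c (h x)) by apply: imset_f.
by rewrite -(cP _ hC).2.
Qed.

Lemma perm_of_12factor F : is_12factor F -> exists s, perm_edges s = F.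
Proof.
case/cycles_of_12factor=> p [p_uniq mem_p p_const ->].
have nextK : cancel (fun x => next (p x) x) (fun x => prev (p x) x).
  by move=> x; rewrite (p_const x) ?mem_next // prev_next.
exists (perm (can_inj nextK)).
by apply: eq_imset => x; rewrite permE.
Qed.

Lemma num_12factorsE : num_12factors G = #|perm_supports (edges G)|.
Proof.
apply: eq_card => F; rewrite inE; apply/idP/imsetP => [facF|[s]].
  have [s sF] := perm_of_12factor facF; exists s => //.
  by rewrite inE sF; case/and3P: facF.
by rewrite inE => sE ->; apply: perm_edges_12factor.
Qed.

Lemma weighted_adjmxE (w : {set G} -> int) :
  weighted_adjmx w = edge_mx (edges G) w.
Proof. by apply/matrixP => i j; rewrite !mxE /= mem_edges. Qed.

End FactorsArePermutations.

Lemma int_rank_lt n (A : 'M[int]_n) : (int_rank A < n) = (\det A == 0)%R.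
Proof.
have := row_free_unit (map_mx (intr : int -> rat) A).
rewrite unitmxE det_map_mx unitfE intr_eq0 => free_det.
by rewrite ltn_neqAle rank_leq_row andbT -/(row_free _) free_det negbK.
Qed.

(* Without a {1,2}-factor the equivalence fails: the determinant then vanishes
   for every weight, although the number of {1,2}-factors is 0 (e.g. K_1). *)
Theorem theorem3p1 (G : sgraph) (hG : 0 < num_12factors G) :
  (exists w : {set G} -> int,
     is_weight w /\ int_rank (weighted_adjmx w) < #|G|)
  <-> 2 <= num_12factors G.
Proof.
split=> [[w [wnz]]|].
  rewrite int_rank_lt weighted_adjmxE ltn_neqAle hG andbT.
  apply: contraL => /eqP t1.
  by apply: det_edge_mx_unique_support => //; rewrite -num_12factorsE -t1.
rewrite num_12factorsE.
case/(exists_int_singular_weight (@edges_loopless G)) => w wnz det0.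
by exists w; rewrite int_rank_lt weighted_adjmxE det0.
Qed.
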